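(* Let $A,V\in\mathbb{R}^{d\times d}$ be symmetric positive definite, $b\in\mathbb{R}^d$, $h>0$ and $L\in\mathbb{N}$. Let $K,J\in\mathbb{R}^{2d\times2d}$ be $$K=\begin{bmatrix}I-\tfrac{h^2}2VA&hV\\-hA+\tfrac{h^3}4AVA&I-\tfrac{h^2}2AV\end{bmatrix},\qquad J=\begin{bmatrix}2I&hV\\-\tfrac h2A&2I-\tfrac{h^2}2AV\end{bmatrix},$$ and $S=(I-K)^{-1}(I-K^L)$. Assume that the spectral radius of $(K^L)_{11}$ is less than $1$ and that $(K^L)_{12}$ is invertible. The HMC proposal $$y=(K^L)_{11}x+\Big(SJ\begin{bmatrix}0\\\tfrac h2b\end{bmatrix}\Big)_1+(K^L)_{12}\,\xi,\qquad \xi\sim N(0,V^{-1}),$$ corresponds to the matrix splitting $\mathcal{A}=M-N$ with vector $\beta$ given by $$M=\Sigma^{-1}(I+(K^L)_{11}),\qquad \mathcal{A}=\Sigma^{-1}(I-(K^L)_{11}^2),$$ $$N=\Sigma^{-1}(I+(K^L)_{11})(K^L)_{11},\qquad \beta=\Sigma^{-1}(I+(K^L)_{11})\Big(SJ\begin{bmatrix}0\\\tfrac h2b\end{bmatrix}\Big)_1,$$ where $\Sigma=(K^L)_{12}V^{-1}(K^L)_{12}^T$.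
   Context: $N(m,C)$ is the normal distribution with mean $m$ and covariance $C$. $(K^L)_{ij}$ is the $ij$ block (of size $d\times d$) of $K^L$, and $(\cdot)_1$ denotes the first $d$ entries of a vector in $\mathbb{R}^{2d}$. This HMC proposal for target $N(A^{-1}b,A^{-1})$ is $y=q_L$, where $q_0=x$, $p_0\sim N(0,V^{-1})$ and for $l=0,\dots,L-1$: $p_{l+1/2}=p_l-\tfrac h2(Aq_l-b)$, $q_{l+1}=q_l+hVp_{l+1/2}$, $p_{l+1}=p_{l+1/2}-\tfrac h2(Aq_{l+1}-b)$. An AR(1) proposal $y=Gx+g+\nu$, $\nu\sim N(0,\Sigma)$, is said to correspond to the matrix splitting $\mathcal{A}=M-N$ with vector $\beta$ if $M$ is invertible, $G=M^{-1}N$, $g=M^{-1}\beta$ and $\Sigma=M^{-1}(M^T+N)M^{-T}$; equivalently, $My=Nx+\beta+\nu'$ with $\nu'\sim N(0,M^T+N)$. *)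

(* Defs.v *)
From HB Require Import structures.
From mathcomp Require Import all_boot all_order all_algebra.
From mathcomp Require Import all_classical all_reals all_analysis.
From mathcomp Require Import complex.

Set Implicit Arguments.
Unset Strict Implicit.
Unset Printing Implicit Defensive.

Import Order.TTheory GRing.Theory Num.Theory.
Import numFieldNormedType.Exports.

Local Open Scope classical_set_scope.
Local Open Scope ring_scope.

Definition spd (R : realType) (d : nat) (A : 'M[R]_d) : Prop :=
  A^T = A /\ forall u : 'cV[R]_d, u != 0 -> 0 < (u^T *m A *m u) 0 0.

(* The eigenvalues are the complex ones.  (For d = 0 the set is empty and
   the supremum is 0.) *)
Definition spectral_radius (R : realType) (d : nat) (A : 'M[R]_d) : R :=
  sup [set r : R | exists2 z : R[i],
    eigenvalue (map_mx (real_complex R) A) z & r = ComplexField.Normc.normc z].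

(* The one-dimensional N(m, v), parametrised by its variance v; the library's
   normal_prob takes the standard deviation and is not the Dirac mass at m when
   the latter is 0. *)
Definition normal1 (R : realType) (m v : R) : set R -> \bar R :=
  if v == 0 then dirac m else normal_prob m (Num.sqrt v).

(* X ~ N(m, C) on R^d, possibly degenerate: every linear functional u^T X has
   law N(u^T m, u^T C u).  The library has no measurable structure on 'cV[R]_d,
   so measurability of X is stated coordinatewise. *)
Definition normal_vector (R : realType) (disp : measure_display)
    (T : measurableType disp) (P : probability T R) (d : nat)
    (X : T -> 'cV[R]_d) (m : 'cV[R]_d) (C : 'M[R]_d) : Prop :=
  [/\ C^T = C,
      forall u : 'cV[R]_d, 0 <= (u^T *m C *m u) 0 0,
      forall i : 'I_d, measurable_fun [set: T] (fun t => X t i 0) &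
      forall (u : 'cV[R]_d) (B : set R), measurable B ->
        P [set t | B ((u^T *m X t) 0 0)]
        = normal1 ((u^T *m m) 0 0) ((u^T *m C *m u) 0 0) B].

(* A proposal is a map y : R^d -> T -> R^d, with y x the random vector proposed
   from the current state x.  The noise of an AR(1) proposal is the same random
   vector nu for all x. *)
Definition ar1_proposal (R : realType) (disp : measure_display)
    (T : measurableType disp) (P : probability T R) (d : nat)
    (y : 'cV[R]_d -> T -> 'cV[R]_d)
    (G : 'M[R]_d) (g : 'cV[R]_d) (Sigma : 'M[R]_d) : Prop :=
  exists2 nu : T -> 'cV[R]_d, normal_vector P nu 0 Sigma &
    forall x t, y x t = G *m x + g + nu t.

Definition corresponds_to_splitting (R : realType) (disp : measure_display)
    (T : measurableType disp) (P : probability T R) (d : nat)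
    (y : 'cV[R]_d -> T -> 'cV[R]_d)
    (G : 'M[R]_d) (g : 'cV[R]_d) (Sigma : 'M[R]_d)
    (calA M N : 'M[R]_d) (beta : 'cV[R]_d) : Prop :=
  ar1_proposal P y G g Sigma /\
  [/\ calA = M - N,
      M \in unitmx,
      G = invmx M *m N,
      g = invmx M *m beta &
      Sigma = invmx M *m (M^T + N) *m (invmx M)^T].

Definition leapfrog (R : realType) (d : nat) (A V : 'M[R]_d) (b : 'cV[R]_d)
    (h : R) (qp : 'cV[R]_d * 'cV[R]_d) : 'cV[R]_d * 'cV[R]_d :=
  let phalf := qp.2 - (h / 2) *: (A *m qp.1 - b) in
  let q := qp.1 + h *: (V *m phalf) in
  (q, phalf - (h / 2) *: (A *m q - b)).

(* q_L as a function of q_0 = x and p_0. *)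
Definition hmc_proposal (R : realType) (d : nat) (A V : 'M[R]_d) (b : 'cV[R]_d)
    (h : R) (L : nat) (x p0 : 'cV[R]_d) : 'cV[R]_d :=
  (iter L (leapfrog A V b h) (x, p0)).1.

Definition hmcK (R : realType) (d : nat) (A V : 'M[R]_d) (h : R)
    : 'M[R]_(d + d) :=
  block_mx (1%:M - (h ^+ 2 / 2) *: (V *m A)) (h *: V)
           (- (h *: A) + (h ^+ 3 / 4) *: (A *m V *m A))
           (1%:M - (h ^+ 2 / 2) *: (A *m V)).

Definition hmcJ (R : realType) (d : nat) (A V : 'M[R]_d) (h : R)
    : 'M[R]_(d + d) :=
  block_mx (2%:M) (h *: V)
           (- ((h / 2) *: A)) (2%:M - (h ^+ 2 / 2) *: (A *m V)).

Definition hmcS (R : realType) (d : nat) (A V : 'M[R]_d) (h : R) (L : nat)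
    : 'M[R]_(d + d) :=
  invmx (1%:M - hmcK A V h) *m (1%:M - hmcK A V h ^+ L).

(* (S J [0; (h/2) b])_1 *)
Definition hmc_shift (R : realType) (d : nat) (A V : 'M[R]_d) (b : 'cV[R]_d)
    (h : R) (L : nat) : 'cV[R]_d :=
  usubmx (hmcS A V h L *m hmcJ A V h *m col_mx 0 ((h / 2) *: b)).

(* Main.v *)
Require Import Defs.
From HB Require Import structures.
From mathcomp Require Import all_boot all_order all_algebra.
From mathcomp Require Import all_classical all_reals all_analysis.
From mathcomp Require Import measurable_realfun complex ring.

(** Since the force is affine in the position, a leapfrog step is an affine map
    [z |-> K z + J (0, h b / 2)] of the phase space ([leapfrog_affine]); summing
    a geometric series gives the closed form of [L] steps, whose first
    component is the stated AR(1) proposal ([hmc_proposalE]).  The series can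
    be summed because [I - K] has an explicit inverse ([hmcK_sub1_unitmx]).

    The noise [K12 xi] is a linear image of a normal vector, so its law is
    [N(0, Sigma)] ([normal_vector_mulmx]).  The matrix [M] is invertible
    because a spectral radius less than 1 keeps [-1] out of the spectrum of
    [K11] ([spectral_radius_lt1_unitmx]).  Then [calA = M - N], [G = M^-1 N] and
    [g = M^-1 beta] are immediate, and the covariance identity
    [Sigma = M^-1 (M^T + N) M^-T] is what remains.  It follows from the
    symmetry of [M] ([splitting_of_reversible]), that is, from detailed balance
    [K11 Sigma = Sigma K11^T] ([hmc_detailed_balance]).

    Detailed balance has an algebraic source: the first block row of [K^L] is
    [(p(V A), q(V A) V)] for two real polynomials [p] and [q]
    ([hmcK_exp_urow]).  Polynomials in [V A] commute with each other, and
    because [A] and [V] are symmetric they are intertwined with their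
    transposes by [V] ([horner_mx_intertwine]). *)

Set Implicit Arguments.
Unset Strict Implicit.
Unset Printing Implicit Defensive.

Import Order.TTheory GRing.Theory Num.Theory.
Import numFieldNormedType.Exports.

Local Open Scope ring_scope.

(** * Invertibility of the matrices of the problem *)

Lemma spd_unitmx (R : realType) (d : nat) (A : 'M[R]_d) : spd A -> A \in unitmx.
Proof.
move=> [_ Apos]; rewrite unitmxE unitfE; apply/det0P => -[v v0 vA0].
have := Apos v^T; rewrite trmxK vA0 mul0mx mxE ltxx trmx_eq0.
by move=> /(_ v0).
Qed.

(** Brings a matrix expression to a linear combination of left-associated
    words, after which its equalities hold coefficient by coefficient. *)
Definition expand_mx := (mulmxDl, mulmxDr, mulmxBl, mulmxBr, mulNmx, mulmxN,
  =^~ scalemxAl, =^~ scalemxAr, mul_scalar_mx, mul_mx_scalar, mulmxA).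

(** A fixed point [(u, v)] of [K] has [v = (h / 2) A u] by its first row, and
    then the second row says [h A u = 0].  Solving the inhomogeneous system in
    the same way produces the explicit inverse [W] below. *)
Lemma hmcK_sub1_unitmx (R : realType) (d : nat) (A V : 'M[R]_d) (h : R) :
  A \in unitmx -> V \in unitmx -> h != 0 -> 1%:M - hmcK A V h \in unitmx.
Proof.
move=> Au Vu h0.
pose W := block_mx (2^-1)%:M (h^-1 *: invmx A)
  ((h / 4) *: A - h^-1 *: invmx V) (2^-1)%:M.
suff /mulmx1_unit[] : (1%:M - hmcK A V h) *m W = 1%:M by [].
rewrite /hmcK scalar_mx_block opp_block_mx add_block_mx mulmx_block.
by congr block_mx; rewrite !expand_mx ?(mulmxK, mulmxKV, mulmxV) //;
  rewrite -?mulmxA ?mulmxV // ?mulmx1 ?mulmxA ?mul0mx;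
  move: (A *m V *m A) (A *m V) (V *m A) => X Y Z;
  apply/matrixP => i j; rewrite !mxE; case: (i == j) => /=; field.
Qed.

(** * The leapfrog map *)

(** One leapfrog step is affine, because the force [b - A q] is; its constant
    part is the image under [J] of the half kick [(h / 2) b]. *)
Lemma leapfrog_affine (R : realType) (d : nat) (A V : 'M[R]_d) (b : 'cV[R]_d)
    (h : R) (q p : 'cV[R]_d) :
  let qp := leapfrog A V b h (q, p) in
  col_mx qp.1 qp.2
  = hmcK A V h *m col_mx q p + hmcJ A V h *m col_mx 0 ((h / 2) *: b).
Proof.
rewrite /leapfrog /hmcK /hmcJ /= !mul_block_col add_col_mx !mulmx0 !add0r.
by congr col_mx; rewrite !expand_mx;
  move: (A *m V *m A *m q) (A *m V *m p) (A *m q) (A *m V *m b)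
    (V *m A *m q) (V *m p) (V *m b) => X1 X2 X3 X4 X5 X6 X7;
  apply/matrixP => i j; rewrite !mxE; field.
Qed.

(** Iterating [z |-> K z + w] gives [K^L z + (I + K + ... + K^(L-1)) w], and
    [S] is the sum of this geometric series. *)
Lemma iter_leapfrog (R : realType) (d : nat) (A V : 'M[R]_d) (b : 'cV[R]_d)
    (h : R) (L : nat) (x p0 : 'cV[R]_d) :
  1%:M - hmcK A V h \in unitmx ->
  let qp := iter L (leapfrog A V b h) (x, p0) in
  col_mx qp.1 qp.2
  = hmcK A V h ^+ L *m col_mx x p0
    + hmcS A V h L *m hmcJ A V h *m col_mx 0 ((h / 2) *: b).
Proof.
move=> IKu; rewrite /= /hmcS -mulmxA.
set w := hmcJ A V h *m _; set K := hmcK A V h; set X := 1%:M - K.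
elim: L => [|L IH].
  by rewrite expr0 mul1mx subrr mulmx0 mul0mx addr0.
rewrite iterS [iter L _ _]surjective_pairing leapfrog_affine IH -/K -/w.
rewrite mulmxDr exprS -mulmxE !(mulmxA K) -addrA; congr (_ + _).
rewrite -[X in _ + X = _]mul1mx -mulmxDl; congr (_ *m _).
(* Times [I - K], the claim reads [K (I - K^L) + (I - K) = I - K^(L+1)]. *)
have XK : X *m K = K *m X by rewrite mulmxBl mulmxBr mul1mx mulmx1.
apply: (can_inj (mulKmx IKu)).
rewrite mulmxDr !mulmxA XK mulmxK // mulmxV // mul1mx mulmxBr !mulmx1.
by rewrite /X addrC -addrA (addrA (- K)) addNr add0r.
Qed.

Lemma hmc_proposalE (R : realType) (d : nat) (A V : 'M[R]_d) (b : 'cV[R]_d)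
    (h : R) (L : nat) (x p0 : 'cV[R]_d) :
  1%:M - hmcK A V h \in unitmx ->
  hmc_proposal A V b h L x p0
  = ulsubmx (hmcK A V h ^+ L) *m x + hmc_shift A V b h L
    + ursubmx (hmcK A V h ^+ L) *m p0.
Proof.
move=> IKu; have /(congr1 usubmx) := iter_leapfrog b L x p0 IKu.
rewrite /= col_mxKu /hmc_proposal /hmc_shift => ->.
rewrite -{1}(submxK (hmcK A V h ^+ L)) mul_block_col.
by rewrite [usubmx (_ + _)]linearD /= col_mxKu addrAC.
Qed.

(** * Polynomial structure of the powers of K *)

(** With [B = V A], the first block row of [K] is [(c(B), h V)], and the second
    one becomes [(e(B), c(B) V)] after multiplication by [V] on the left, for
    the polynomials [c] and [e] below.  Hence the first block row of the powers
    of [K] evolves on its own, as a pair of polynomials in [B]: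
    [(p(B), q(B) V) K = ((p c + q e)(B), (h p + q c)(B) V)]
    with [c = 1 - h^2 X / 2] and [e = - h X + h^3 X^2 / 4]. *)
Lemma hmcK_exp_urow (R : realType) (n : nat) (A V : 'M[R]_n.+1) (h : R)
    (L : nat) :
  exists p q : {poly R},
    usubmx (hmcK A V h ^+ L)
    = row_mx (horner_mx (V *m A) p) (horner_mx (V *m A) q *m V).
Proof.
elim: L => [|L [p [q IH]]].
  exists 1, 0; rewrite expr0 rmorph1 rmorph0 mul0mx.
  by rewrite -[1]/(1%:M) scalar_mx_block /block_mx col_mxKu.
set H := horner_mx (V *m A) in IH *.
pose c : {poly R} := 1 - (h ^+ 2 / 2) *: 'X.
pose e : {poly R} := - (h *: 'X) + (h ^+ 3 / 4) *: 'X^2.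
exists (p * c + q * e), (h *: p + q * c).
have HcE : H c = 1%:M - (h ^+ 2 / 2) *: (V *m A).
  by rewrite /H rmorphB rmorph1 /= horner_mxZ horner_mx_X.
have HeE : H e = - (h *: (V *m A)) + (h ^+ 3 / 4) *: (V *m A *m (V *m A)).
  by rewrite /H rmorphD rmorphN /= !horner_mxZ rmorphXn /= horner_mx_X expr2.
have -> : usubmx (hmcK A V h ^+ L.+1) = usubmx (hmcK A V h ^+ L) *m hmcK A V h.
  by rewrite exprSr -mulmxE mul_usub_mx.
rewrite IH /hmcK mul_row_block; congr row_mx.
  rewrite /H rmorphD !rmorphM /= -!mulmxE -/H HcE HeE; congr (_ + _).
  by rewrite -!mulmxA; congr (_ *m _);
     rewrite mulmxDr mulmxN -!scalemxAr !mulmxA.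
rewrite /H rmorphD rmorphM /= horner_mxZ -/H HcE -!mulmxE mulmxDl.
rewrite -scalemxAl -scalemxAr; congr (_ + _).
by rewrite -!mulmxA; congr (_ *m _);
   rewrite mulmxBr mulmxBl mulmx1 mul1mx -scalemxAr -scalemxAl !mulmxA.
Qed.

(** For invertible [V] the hypothesis says that [B] and [B^T] are conjugate by
    [V], and so are their polynomials. *)
Lemma horner_mx_intertwine (R : comNzRingType) (n : nat) (B V : 'M[R]_n.+1)
    (p : {poly R}) :
  B *m V = V *m B^T -> horner_mx B p *m V = V *m (horner_mx B p)^T.
Proof.
move=> BV; elim/poly_ind: p => [|p c IH].
  by rewrite rmorph0 trmx0 mul0mx mulmx0.
rewrite rmorphD rmorphM /= horner_mx_X horner_mx_C -mulmxE linearD /=.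
rewrite mulmxDl mulmxDr tr_scalar_mx scalar_mxC; congr (_ + _).
rewrite -mulmxA BV mulmxA IH -!mulmxA -!trmx_mul; congr (_ *m _^T).
rewrite !mulmxE -[X in _ = _ * X](horner_mx_X B).
by rewrite -[X in X * _ = _](horner_mx_X B) -!rmorphM mulrC.
Qed.

(** The detailed balance of the proposal chain: [K11] is self-adjoint for the
    inner product of [Sigma^-1].  Writing [K11 = P] and [K12 = Q V] with [P]
    and [Q] polynomials in [V A], one has [P V = V P^T] and [Q V = V Q^T] as
    [(V A) V = V (V A)^T], so that [Sigma = Q V Q^T = Q^2 V] and both sides
    equal [P Q^2 V]. *)
Lemma hmc_detailed_balance (R : realType) (d : nat) (A V : 'M[R]_d) (h : R)
    (L : nat) :
  A^T = A -> V^T = V -> V \in unitmx ->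
  let K11 := ulsubmx (hmcK A V h ^+ L) in
  let K12 := ursubmx (hmcK A V h ^+ L) in
  let Sigma := K12 *m invmx V *m K12^T in
  K11 *m Sigma = Sigma *m K11^T.
Proof.
(* Evaluation of polynomials at a matrix needs a nonempty index set. *)
case: d A V => [|n] A V symA symV Vu /=; first by rewrite !flatmx0.
have [p [q pq]] := hmcK_exp_urow A V h L.
have -> : ulsubmx (hmcK A V h ^+ L) = horner_mx (V *m A) p.
  by rewrite /ulsubmx pq row_mxKl.
have -> : ursubmx (hmcK A V h ^+ L) = horner_mx (V *m A) q *m V.
  by rewrite /ursubmx pq row_mxKr.
have comm r : horner_mx (V *m A) r *m V = V *m (horner_mx (V *m A) r)^T.
  by apply: horner_mx_intertwine; rewrite trmx_mul symA symV mulmxA.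
rewrite mulmxK // trmx_mul symV.
set P := horner_mx _ p in comm *; set Q := horner_mx _ q.
have PQ : P *m Q = Q *m P by rewrite !mulmxE -!rmorphM mulrC.
have := comm p; have := comm q; rewrite -/P -/Q => <- PV.
by rewrite !mulmxA PQ -!mulmxA -PV !mulmxA -(mulmxA Q P) PQ !mulmxA.
Qed.

(** * Spectral radius *)

(** The supremum of a set without upper bound is a junk value, so the point is
    that the moduli of the eigenvalues are bounded: the characteristic
    polynomial splits over the complex numbers, and each eigenvalue is one of
    finitely many roots, with modulus at most the sum of all their moduli. *)
Lemma spectral_radius_ge (R : realType) (d : nat) (A : 'M[R]_d) (z : R[i]) :
  eigenvalue (map_mx (real_complex R) A) z ->
  ComplexField.Normc.normc z <= spectral_radius A.
Proof.
move=> Az; apply: ub_le_sup; last by exists z.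
have [s sE] := closed_field_poly_normal
  (char_poly (map_mx (real_complex R) A)).
have normc_ge0 (w : R[i]) : 0 <= ComplexField.Normc.normc w.
  by case: w => x y; rewrite sqrtr_ge0.
exists (\sum_(w <- s) ComplexField.Normc.normc w) => r [w Aw ->].
have ws : w \in s.
  move: Aw; rewrite eigenvalue_root_char sE rootZ ?root_prod_XsubC //.
  by rewrite lead_coef_eq0 monic_neq0 // char_poly_monic.
by rewrite (big_rem w ws) /= lerDl sumr_ge0.
Qed.

(** A kernel vector of [I + A] would make [-1], of modulus 1, an eigenvalue. *)
Lemma spectral_radius_lt1_unitmx (R : realType) (d : nat) (A : 'M[R]_d) :
  spectral_radius A < 1 -> 1%:M + A \in unitmx.
Proof.
move=> rho; rewrite unitmxE unitfE; apply/det0P => -[v v0].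
rewrite mulmxDr mulmx1 => /eqP; rewrite addrC addr_eq0 => /eqP vA.
have /spectral_radius_ge :
    eigenvalue (map_mx (real_complex R) A) (real_complex R (-1)).
  by rewrite eigenvalue_map; apply/eigenvalueP; exists v; rewrite // scaleN1r.
rewrite /= expr0n /= addr0 sqrrN expr1n sqrtr1 => /le_lt_trans/(_ rho).
by rewrite ltxx.
Qed.

(** * Gaussian noise and the splitting *)

(** A linear functional of [W X] is one of [X]: [u^T (W X) = (W^T u)^T X]. *)
Lemma normal_vector_mulmx (R : realType) (disp : measure_display)
    (T : measurableType disp) (P : probability T R) (d e : nat)
    (X : T -> 'cV[R]_d) (m : 'cV[R]_d) (C : 'M[R]_d) (W : 'M[R]_(e, d)) :
  normal_vector P X m C ->
  normal_vector P (fun t => W *m X t) (W *m m) (W *m C *m W^T).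
Proof.
move=> [symC Cge0 Xmeas Xlaw].
have quadE (u : 'cV[R]_e) :
    u^T *m (W *m C *m W^T) *m u = (W^T *m u)^T *m C *m (W^T *m u).
  by rewrite trmx_mul trmxK !mulmxA.
split.
- by rewrite !trmx_mul trmxK symC mulmxA.
- by move=> u; rewrite quadE.
- move=> i; under eq_fun do rewrite mxE.
  by apply: measurable_sum => j; apply: measurable_funM.
- move=> u B mB; have := Xlaw (W^T *m u) B mB.
  rewrite quadE trmx_mul trmxK !mulmxA => <-.
  by under eq_set do rewrite mulmxA.
Qed.

(** Detailed balance makes [M = Sigma^-1 (I + G)] symmetric, whence
    [M^T + M G = M (I + G) = M Sigma M = M Sigma M^T]. *)
Lemma splitting_of_reversible (F : fieldType) (d : nat) (G Sigma : 'M[F]_d) :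
  Sigma^T = Sigma -> Sigma \in unitmx -> 1%:M + G \in unitmx ->
  G *m Sigma = Sigma *m G^T ->
  let M := invmx Sigma *m (1%:M + G) in
  Sigma = invmx M *m (M^T + M *m G) *m (invmx M)^T.
Proof.
move=> symS Su Gu GS M.
have Mu : M \in unitmx by rewrite unitmx_mul unitmx_inv Su.
have MT : M^T = M.
  apply: (can_inj (mulKmx Su)); apply: (can_inj (mulmxK Su)).
  rewrite /M trmx_mul trmx_inv symS mulmxA mulmxKV // mulKVmx //.
  by rewrite linearD /= trmx1 mulmxDl mulmxDr mul1mx mulmx1 GS.
have MSM : M^T + M *m G = M *m Sigma *m M^T.
  by rewrite MT {3}/M -mulmxA mulKVmx // mulmxDr mulmx1.
rewrite MSM; move: (M) Mu => W Wu.
by rewrite -!mulmxA mulKmx // -trmx_mul mulVmx // trmx1 mulmx1.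
Qed.

Theorem theorem5p6 (R : realType) (disp : measure_display)
    (T : measurableType disp) (P : probability T R)
    (d : nat) (A V : 'M[R]_d) (b : 'cV[R]_d) (h : R) (L : nat)
    (xi : T -> 'cV[R]_d)
    (hA : spd A) (hV : spd V) (hh : 0 < h)
    (hrho : spectral_radius (ulsubmx (hmcK A V h ^+ L)) < 1)
    (hK12 : ursubmx (hmcK A V h ^+ L) \in unitmx)
    (hxi : normal_vector P xi 0 (invmx V)) :
  let K11 := ulsubmx (hmcK A V h ^+ L) in
  let K12 := ursubmx (hmcK A V h ^+ L) in
  let g := hmc_shift A V b h L in
  let Sigma := K12 *m invmx V *m K12^T in
  let y := fun (x : 'cV[R]_d) (t : T) => K11 *m x + g + K12 *m xi t in
  let M := invmx Sigma *m (1%:M + K11) in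
  let calA := invmx Sigma *m (1%:M - K11 *m K11) in
  let N := invmx Sigma *m (1%:M + K11) *m K11 in
  let beta := invmx Sigma *m (1%:M + K11) *m g in
  [/\ 1%:M - hmcK A V h \in unitmx,
      Sigma \in unitmx,
      forall (x : 'cV[R]_d) (t : T), hmc_proposal A V b h L x (xi t) = y x t &
      corresponds_to_splitting P y K11 g Sigma calA M N beta].
Proof.
move=> K11 K12 g Sigma y M calA N beta.
have [[symA _] [symV _]] := (hA, hV).
have Vu := spd_unitmx hV.
have IKu := hmcK_sub1_unitmx (spd_unitmx hA) Vu (lt0r_neq0 hh).
have Su : Sigma \in unitmx.
  by rewrite !unitmx_mul unitmx_tr unitmx_inv Vu hK12.
have Gu := spectral_radius_lt1_unitmx hrho.
have Mu : M \in unitmx by rewrite unitmx_mul unitmx_inv Su.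
have nuP : normal_vector P (fun t => K12 *m xi t) 0 Sigma.
  by rewrite -[0](mulmx0 _ K12); apply: normal_vector_mulmx.
split=> //; first by move=> x t; exact: hmc_proposalE.
split; first by exists (fun t => K12 *m xi t).
split=> //.
- rewrite /calA /M /N -mulmxA -mulmxBr mulmxDl mul1mx.
  by rewrite opprD addrA addrK.
- by rewrite /N mulKmx.
- by rewrite /beta mulKmx.
- apply: splitting_of_reversible => //; first by case: nuP.
  exact: hmc_detailed_balance.
Qed.
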